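(* Let $\gamma>1$, $\varepsilon\in(0,1]$, $\eta>0$, let $(\mathcal M,\mathcal E)$ be a MAC grid of $\Omega$, $\delta t>0$, $N\ge1$. Let $(\rho^n,\boldsymbol u^n,\theta^n)_{0\le n\le N}$ be a solution, with $\rho^n>0$ and $\theta^n>0$, of the following scheme for $0\le n\le N-1$: $$\frac{1}{\delta t}(\rho_K^{n+1}-\rho_K^n)+\frac1{|K|}\sum_{\sigma\in\mathcal E(K)}F_{\sigma,K}(\rho^n,\boldsymbol u^n)=0,\quad \forall K\in\mathcal M,$$ $$\frac1{\delta t}(\rho^{n+1}_{D_\sigma}u^{n+1}_\sigma-\rho^n_{D_\sigma}u^n_\sigma)+\frac1{|D_\sigma|}\sum_{\epsilon\in\tilde{\mathcal E}(D_\sigma)}F_{\epsilon,\sigma}(\rho^n,\boldsymbol u^n)u^n_{\epsilon,\mathrm{up}}+\frac1{\varepsilon^2}(\partial^{(i)}_{\mathcal E}p^{n+1})_\sigma=0,\quad 1\le i\le d,\ \forall\sigma\in\mathcal E^{(i)}_{\mathrm{int}},$$ $$\frac1{\delta t}(\rho^{n+1}_K\theta^{n+1}_K-\rho^n_K\theta^n_K)+\frac1{|K|}\sum_{\sigma\in\mathcal E(K)}F_{\sigma,K}(\rho^{n+1}\theta^{n+1},\boldsymbol v^{n+1})=0,\quad\forall K\in\mathcal M,$$ where $p^{n+1}_K=(\rho_K^{n+1}\theta_K^{n+1})^\gamma$. Then, for each $0\le n\le N-1$, the energy inequality $$\frac1{\varepsilon^2}\sum_{K\in\mathcal M}|K|\Pi_\gamma(\rho^{n+1}_K\theta^{n+1}_K)+\sum_{\sigma\in\mathcal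 E_{\mathrm{int}}}|D_\sigma|\frac12\rho^{n+1}_{D_\sigma}(u^{n+1}_\sigma)^2\le\frac1{\varepsilon^2}\sum_{K\in\mathcal M}|K|\Pi_\gamma(\rho^{n}_K\theta^{n}_K)+\sum_{\sigma\in\mathcal E_{\mathrm{int}}}|D_\sigma|\frac12\rho^{n}_{D_\sigma}(u^{n}_\sigma)^2$$ holds under the following two conditions: (i) $\eta\ge\dfrac{3}{2\rho^n_{D_\sigma}}$ for all $\sigma\in\mathcal E^{(i)}_{\mathrm{int}}$, $1\le i\le d$; (ii) $\dfrac{\delta t}{|K|}\displaystyle\sum_{\sigma\in\mathcal E(K)}\frac{|F_{\sigma,K}(\rho^n,\boldsymbol u^n)|}{\rho^n_K}\le\frac13$ for all $K\in\mathcal M$.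
   Context: Energy. $\psi_\gamma(z)=\frac{z^\gamma}{\gamma-1}$ and $\Pi_\gamma(z)=\psi_\gamma(z)-\psi_\gamma(1)-\psi_\gamma'(1)(z-1)$. Grid. $\Omega$ is a $d$-dimensional box, $d\in\{1,2,3\}$, with periodic boundary conditions (i.e. identified with the torus $\mathbb T^d$). A MAC grid $(\mathcal M,\mathcal E)$ consists of a primal mesh $\mathcal M$: a conforming, structured, possibly non-uniform partition of $\bar\Omega$ into closed axis-parallel boxes $K$ (primal cells), and the set $\mathcal E$ of their faces $\sigma$. $\mathcal E^{(i)}$ is the set of faces orthogonal to the $i$-th unit vector $\boldsymbol e^{(i)}$; $\mathcal E(K)$ is the set of faces of $K$. Because of periodicity every face is internal, $\mathcal E_{\mathrm{int}}=\mathcal E$, $\mathcal E^{(i)}_{\mathrm{int}}=\mathcal E^{(i)}$, and each face is $\sigma=K|L$, the common face of two cells $K\ne L$. $|K|$ and $|\sigma|$ denote $d$- and $(d-1)$-dimensional measures ($|\sigma|=1$ if $d=1$). The dual cell $D_\sigma$ of $\sigma=K|L$ is the union of the halves of $K$ and $L$ adjacent to $\sigma$, so $|D_\sigma|=\frac12(|K|+|L|)$; $\tilde{\mathcal E}(D_\sigma)$ is the set of faces $\epsilon$ of $D_\sigma$, and $\epsilon=D_\sigma|D_{\sigma'}$ is the face shared by the dual cells of $\sigma,\sigma'\in\mathcal E^{(i)}$. Discrete unknowns. $\rho^n,\theta^n$ are constant on each $K\in\mathcal M$ (values $\rho^n_K,\theta^n_K$); $\boldsymbol u^n$ is a vector field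 whose $i$-th component is constant on each $D_\sigma$, $\sigma\in\mathcal E^{(i)}$ (value $u^n_\sigma$). Notation. $a^+=\max\{a,0\}$, $a^-=\min\{a,0\}$. $\boldsymbol\nu_{\sigma,K}$ is the unit normal to $\sigma$ outward to $K$, and $u_{\sigma,K}=u_\sigma\,\boldsymbol e^{(i)}\cdot\boldsymbol\nu_{\sigma,K}$ for $\sigma\in\mathcal E^{(i)}\cap\mathcal E(K)$. For $\sigma=K|L\in\mathcal E^{(i)}$, $(\partial^{(i)}_{\mathcal E}q)_\sigma=\frac{|\sigma|}{|D_\sigma|}(q_L-q_K)\,\boldsymbol e^{(i)}\cdot\boldsymbol\nu_{\sigma,K}$. Mass flux ($\sigma=K|L$): $F_{\sigma,K}(\rho,\boldsymbol u)=|\sigma|\{\rho_K u_{\sigma,K}^++\rho_L u_{\sigma,K}^-\}$. Dual density: $|D_\sigma|\rho_{D_\sigma}=\frac12|K|\rho_K+\frac12|L|\rho_L$. Dual mass fluxes, for $\sigma=K|L\in\mathcal E^{(i)}$, with $F_{\sigma,K}=F_{\sigma,K}(\rho,\boldsymbol u)$: if $\epsilon\subset K$ is orthogonal to $\boldsymbol e^{(i)}$ and $\sigma'$ is the face of $K$ opposite to $\sigma$, $F_{\epsilon,\sigma}=\frac12(F_{\sigma',K}-F_{\sigma,K})$ (similarly in $L$); if $\epsilon$ is not orthogonal to $\boldsymbol e^{(i)}$, it is the union of a half of a face $\tau\in\mathcal E(K)$ and a half of a face $\tau'\in\mathcal E(L)$, and $F_{\epsilon,\sigma}=\frac12(F_{\tau,K}+F_{\tau',L})$.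 Upwind value: for $\epsilon=D_\sigma|D_{\sigma'}$, $u_{\epsilon,\mathrm{up}}=u_\sigma$ if $F_{\epsilon,\sigma}\ge0$ and $u_{\epsilon,\mathrm{up}}=u_{\sigma'}$ otherwise. Stabilised velocity and temperature flux: $v^{n+1}_\sigma=u^n_\sigma-\delta u^{n+1}_\sigma$ with $\delta u_\sigma^{n+1}=\frac{\eta\,\delta t}{\varepsilon^2}(\partial_{\mathcal E}^{(i)}p^{n+1})_\sigma$ for $\sigma\in\mathcal E^{(i)}_{\mathrm{int}}$; with $\delta u_{\sigma,K}=\delta u_\sigma\boldsymbol e^{(i)}\cdot\boldsymbol\nu_{\sigma,K}$, set $(v^{n+1}_{\sigma,K})_+=(u^n_{\sigma,K})^+-(\delta u^{n+1}_{\sigma,K})^-$ and $(v^{n+1}_{\sigma,K})_-=(u^n_{\sigma,K})^--(\delta u^{n+1}_{\sigma,K})^+$; then, for $\sigma=K|L$, $$F_{\sigma,K}(\rho^{n+1}\theta^{n+1},\boldsymbol v^{n+1})=|\sigma|\{\rho^{n+1}_K\theta^{n+1}_K(v^{n+1}_{\sigma,K})_++\rho^{n+1}_L\theta^{n+1}_L(v^{n+1}_{\sigma,K})_-\}.$$ *)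

(* Defs.v *)
From HB Require Import structures.
From mathcomp Require Import all_boot all_order all_algebra.
From mathcomp Require Import all_classical all_reals all_analysis.
Import Order.TTheory GRing.Theory Num.Theory.
Import numFieldNormedType.Exports.

Set Implicit Arguments.
Unset Strict Implicit.
Unset Printing Implicit Defensive.

Local Open Scope ring_scope.

Definition pospart {R : realType} (x : R) : R := Num.max x 0.
Definition negpart {R : realType} (x : R) : R := Num.min x 0.

Definition psi {R : realType} (gamma z : R) : R := z `^ gamma / (gamma - 1).

Definition Pi_gamma {R : realType} (gamma z : R) : R :=
  psi gamma z - psi gamma 1 - derive1 (psi gamma) 1 * (z - 1).

(* A conforming structured partition of the box \prod_i [a i, b i] into
   axis-parallel boxes is a tensor product of one-dimensional subdivisions:
   direction i is cut at the nodes a i = x_0 < ... < x_(ncells i) = b i.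
   With periodicity, requiring K != L for every face K|L means that there are
   at least two cells in each direction. Only node i j with j <= ncells i
   matters. *)
Record macGrid (R : realType) (d : nat) (a b : 'I_d -> R) := MacGrid {
  ncells : 'I_d -> nat;
  ncells_gt1 : forall i, (1 < ncells i)%N;
  node : 'I_d -> nat -> R;
  node_first : forall i, node i 0%N = a i;
  node_last : forall i, node i (ncells i) = b i;
  node_lt : forall i j, (j < ncells i)%N -> node i j < node i j.+1 }.

Section Mesh.
Context {R : realType} {d : nat} {a b : 'I_d -> R}.
Context (G : macGrid a b).

(* K is the box \prod_i [node i (K i), node i (K i).+1]. *)
Definition cell : finType := {dffun forall i : 'I_d, 'I_(ncells G i)}.

(* (i, K) is the face of K orthogonal to the i-th unit vector through which
   that vector points out of K. Every face of the periodic mesh arises in this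
   way exactly once, so E^(i) is the set of faces whose first component is i. *)
Definition face : finType := ('I_d * cell)%type.

(* (s, j) is the common face, orthogonal to the j-th unit vector, of the dual
   cell of s and of the dual cell that follows it in direction j. *)
Definition dual_face : finType := (face * 'I_d)%type.
End Mesh.

Section MeshOperations.
Context {R : realType} {d : nat} {a b : 'I_d -> R} {G : macGrid a b}.
Implicit Types (K : cell G) (s : face G) (e : dual_face G).

(* ordS is the cyclic successor, which encodes the periodicity. *)
Definition next_cell (i : 'I_d) K : cell G :=
  [ffun j : 'I_d => if j == i then ordS (K j) else K j].

Definition width (i : 'I_d) (j : 'I_(ncells G i)) : R :=
  node G i j.+1 - node G i j.

Definition cell_vol K : R := \prod_(i < d) width (K i).

Definition dir s : 'I_d := s.1.
Definition lo s : cell G := s.2.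
Definition hi s : cell G := next_cell (dir s) (lo s).

Definition face_area s : R := \prod_(j < d | j != dir s) width (lo s j).

Definition faces K : {set face G} := [set s | (K == lo s) || (K == hi s)].

Definition opp_cell s K : cell G := if K == lo s then hi s else lo s.

(* e^(i) . nu_(s,K), for K a cell adjacent to s, with i = dir s. *)
Definition nu s K : R := if K == lo s then 1 else -1.

Definition dual_vol s : R := (cell_vol (lo s) + cell_vol (hi s)) / 2.

Definition dlo e : face G := e.1.
Definition ddir e : 'I_d := e.2.
Definition dhi e : face G := (dir (dlo e), next_cell (ddir e) (lo (dlo e))).

Definition dual_faces s : {set dual_face G} :=
  [set e | (s == dlo e) || (s == dhi e)].

Definition opp_face e s : face G := if s == dlo e then dhi e else dlo e.

(* Component of a face field u along the outward normal to K. *)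
Definition outward (u : face G -> R) s K : R := u s * nu s K.

(* K = lo s, L = hi s, so that e^(i) . nu_(s,K) = 1. *)
Definition grad (q : cell G -> R) s : R :=
  face_area s / dual_vol s * (q (hi s) - q (lo s)).

Definition mass_flux (rho : cell G -> R) (u : face G -> R) s K : R :=
  face_area s * (rho K * pospart (outward u s K)
                 + rho (opp_cell s K) * negpart (outward u s K)).

Definition dual_density (rho : cell G -> R) s : R :=
  (cell_vol (lo s) * rho (lo s) / 2 + cell_vol (hi s) * rho (hi s) / 2)
  / dual_vol s.

(* First case: e lies inside the primal cell C, and the face of C opposite to s
   is the one whose dual cell lies across e.
   Second case: e is made of halves of the faces t of K = lo s and t' of
   L = hi s, both orthogonal to the direction of e. *)
Definition dual_flux (rho : cell G -> R) (u : face G -> R) e s : R :=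
  let F := mass_flux rho u in
  if ddir e == dir s then
    let C := if s == dlo e then hi s else lo s in
    (F (opp_face e s) C - F s C) / 2
  else
    let t : face G := (ddir e, lo (dlo e)) in
    let t' : face G := (ddir e, hi (dlo e)) in
    (F t (lo s) + F t' (hi s)) / 2.

Definition upwind (rho : cell G -> R) (u : face G -> R) e s : R :=
  if 0 <= dual_flux rho u e s then u s else u (opp_face e s).

Definition pressure (gamma : R) (rho theta : cell G -> R) K : R :=
  (rho K * theta K) `^ gamma.

Definition delta_u (eta dt eps : R) (p : cell G -> R) s : R :=
  eta * dt / eps ^+ 2 * grad p s.

(* Flux F_(s,K)(q, v) for the stabilised velocity v = u - du. *)
Definition stab_flux (q : cell G -> R) (u du : face G -> R) s K : R :=
  let v_plus := pospart (outward u s K) - negpart (outward du s K) in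
  let v_minus := negpart (outward u s K) - pospart (outward du s K) in
  face_area s * (q K * v_plus + q (opp_cell s K) * v_minus).

(* In the three balances, primed unknowns are those at the new time level. *)
Definition mass_balance (dt : R) (rho rho' : cell G -> R) (u : face G -> R) :=
  forall K : cell G,
    dt^-1 * (rho' K - rho K)
    + (cell_vol K)^-1 * \sum_(s in faces K) mass_flux rho u s K = 0.

Definition momentum_balance (gamma eps dt : R)
    (rho rho' theta' : cell G -> R) (u u' : face G -> R) :=
  forall s : face G,
    dt^-1 * (dual_density rho' s * u' s - dual_density rho s * u s)
    + (dual_vol s)^-1 *
      \sum_(e in dual_faces s) dual_flux rho u e s * upwind rho u e s
    + (eps ^+ 2)^-1 * grad (pressure gamma rho' theta') s = 0.

Definition temperature_balance (gamma eps eta dt : R)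
    (rho theta rho' theta' : cell G -> R) (u : face G -> R) :=
  let q' := fun K => rho' K * theta' K in
  let du' := delta_u eta dt eps (pressure gamma rho' theta') in
  forall K : cell G,
    dt^-1 * (rho' K * theta' K - rho K * theta K)
    + (cell_vol K)^-1 * \sum_(s in faces K) stab_flux q' u du' s K = 0.

Definition energy (gamma eps : R) (rho theta : cell G -> R)
    (u : face G -> R) : R :=
  (eps ^+ 2)^-1 * \sum_(K : cell G) cell_vol K * Pi_gamma gamma (rho K * theta K)
  + \sum_(s : face G) dual_vol s * (2^-1 * dual_density rho s * u s ^+ 2).

End MeshOperations.

(* Main.v *)
(* Multiplying the momentum balance by the old velocity u^n and using the dual
   mass balance turns the kinetic energy increment into a telescoping sum of
   upwind energy fluxes, a nonpositive upwind dissipation, the pressure work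
   - |D| g u^n / eps^2 (g is the discrete pressure gradient) and the explicit
   remainder |D| rho' (u' - u)^2 / 2.
   By the momentum balance again, u' - u is the sum of an upwinding part, which
   the CFL condition lets the upwind dissipation absorb, and of a pressure part
   bounded by eta dt |D| g^2 / eps^4.
   On the other side, testing the balance of rho theta with psi' and using the
   convexity of psi and z psi'(z) - psi(z) = z^gamma bounds the increment of the
   internal energy by the work of the stabilised velocity
   v = u^n - eta dt g / eps^2, which cancels exactly both pressure terms. *)
Require Import Defs.
From mathcomp Require Import all_boot all_order all_algebra.
From mathcomp Require Import all_classical all_reals all_analysis.
From mathcomp Require Import ring lra.
Import Order.TTheory GRing.Theory Num.Theory.
Local Open Scope ring_scope.

Set Implicit Arguments.
Unset Strict Implicit.
Unset Printing Implicit Defensive.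

(** * Sums over neighbours and balances without denominators *)

Lemma big_pred2 {R : realType} (T : finType) (x y : T) (f : T -> R) :
  x != y -> \sum_(z | (z == x) || (z == y)) f z = f x + f y.
Proof.
move=> xy; rewrite (bigD1 x) ?eqxx//=; congr (_ + _); apply: big_pred1 => z /=.
by have [->|] := eqVneq z x; rewrite ?andbF ?andbT//= (negPf xy).
Qed.

(** As [next i] has no fixed point, for each [i] exactly two distinct [y] are admissible: [x] and
    its predecessor. The incidences cell-face and face-dual face are both of this kind. *)
Lemma sum_adjacent {R : realType} (I T : finType) (next prev : I -> T -> T)
    (f : I -> T -> R) (x : T) :
  (forall i, cancel (next i) (prev i)) -> (forall i, cancel (prev i) (next i)) ->
  (forall i y, y != next i y) ->
  \sum_(p : I * T | (x == p.2) || (x == next p.1 p.2)) f p.1 p.2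
  = \sum_i (f i x + f i (prev i x)).
Proof.
move=> nextK prevK nextN.
rewrite -(pair_big_dep xpredT
  (fun i y => (x == y) || (x == next i y)) f) /=.
apply: eq_bigr => i _; rewrite -big_pred2; last first.
  by rewrite -{1}(prevK i x) eq_sym nextN.
apply: eq_bigl => y; rewrite eq_sym; congr (_ || _).
by apply/eqP/eqP => [->|->]; rewrite ?nextK ?prevK.
Qed.

Lemma explicit_balance {R : realType} (dt v x S : R) : dt != 0 -> v != 0 ->
  dt^-1 * x + v^-1 * S = 0 -> v * x = - (dt * S).
Proof.
move=> dtN0 vN0 E; apply/eqP; rewrite -subr_eq0 opprK; apply/eqP.
transitivity (dt * v * 0); last by rewrite mulr0.
by rewrite -E; field; rewrite ?dtN0 ?vN0.
Qed.

(** * Positive and negative parts *)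

Section SignedParts.
Context {R : realType}.
Implicit Types x y : R.

Lemma pospart_ge0 x : 0 <= pospart x.
Proof. by rewrite /pospart le_max lexx orbT. Qed.

Lemma negpart_le0 x : negpart x <= 0.
Proof. by rewrite /negpart ge_min lexx orbT. Qed.

Lemma pospartN x : pospart (- x) = - negpart x.
Proof. by rewrite /pospart /negpart oppr_min oppr0. Qed.

Lemma negpartN x : negpart (- x) = - pospart x.
Proof. by rewrite -[x in RHS]opprK pospartN opprK. Qed.

Lemma pos_negpartD x : pospart x + negpart x = x.
Proof.
by rewrite /pospart /negpart; have [x0|x0] := leP x 0; rewrite ?addr0 ?add0r.
Qed.

End SignedParts.

(** * Convexity of the internal energy density *)

Section Psi.
Context {R : realType}.
Variables (gamma : R) (gamma_gt1 : 1 < gamma).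
Implicit Types z w : R.

(** The closed form of the derivative of [psi gamma] on positive reals. *)
Definition dpsi z : R := gamma / (gamma - 1) * z `^ (gamma - 1).

Lemma powR_gamma z : 0 < z -> z `^ gamma = z `^ (gamma - 1) * z.
Proof.
move=> z0; rewrite -[X in _ * X]powRr1 ?ltW// -powRD ?subrK//.
by rewrite (gt_eqF z0) implybT.
Qed.

Lemma dpsi_pressure z : 0 < z -> z * dpsi z - psi gamma z = z `^ gamma.
Proof.
move=> z0; rewrite /dpsi /psi powR_gamma//.
have g0 : gamma - 1 != 0 by rewrite subr_eq0 gt_eqF.
by field.
Qed.

(* Young's inequality applied to the product of z and w^(gamma-1). *)
Lemma psi_tangent z w : 0 < z -> 0 < w ->
  psi gamma w + dpsi w * (z - w) <= psi gamma z.
Proof.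
move=> z0 w0; have g1 : 0 < gamma - 1 by rewrite subr_gt0.
have := @conjugate_powR R z (w `^ (gamma - 1)) gamma (gamma / (gamma - 1))
  (ltW z0) (powR_ge0 _ _).
rewrite -powRrM mulrCA mulfV ?gt_eqF// mulr1.
have ge0 : 0 < gamma by exact: lt_trans gamma_gt1.
have gN0 := lt0r_neq0 ge0; have gN1 := lt0r_neq0 g1.
move=> /(_ ge0 (divr_gt0 ge0 g1)).
have -> : gamma^-1 + (gamma / (gamma - 1))^-1 = 1 by field; rewrite ?gN0 ?gN1.
move=> /(_ erefl).
rewrite /psi /dpsi (powR_gamma w0); move: (w `^ _) (z `^ _) => a c young.
rewrite -subr_ge0.
have -> : c / (gamma - 1) - (a * w / (gamma - 1)
   + gamma / (gamma - 1) * a * (z - w)) =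
  gamma / (gamma - 1) *
    (c / gamma + a * w / (gamma / (gamma - 1)) - z * a) by field; rewrite ?gN0 ?gN1.
by rewrite mulr_ge0 ?subr_ge0// divr_ge0 ?ltW.
Qed.

(** Replace both powers by [dpsi_pressure] and bound [psi] at [z] from below by its tangent at [w].
    In the flux estimate [z] is the value in the donor cell. *)
Lemma pressure_jump_le z w : 0 < z -> 0 < w ->
  z `^ gamma - w `^ gamma <= z * (dpsi z - dpsi w).
Proof.
move=> z0 w0; rewrite -dpsi_pressure// -(dpsi_pressure w0).
have := psi_tangent z0 w0.
by move: (psi _ z) (psi _ w) (dpsi z) (dpsi w) => A B C D; lra.
Qed.

End Psi.

(** * Incidence in the periodic mesh and summation by parts *)

Section MeshSums.
Context {R : realType} {d : nat} {a b : 'I_d -> R} {G : macGrid a b}.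
Implicit Types (K : cell G) (s : face G) (e : dual_face G) (i j : 'I_d).

Definition prev_cell i K : cell G :=
  [ffun j : 'I_d => if j == i then ord_pred (K j) else K j].

Definition prev_face j s : face G := (dir s, prev_cell j (lo s)).

Lemma next_cellK i : cancel (@next_cell R d a b G i) (prev_cell i).
Proof.
by move=> K; apply/ffunP => j; rewrite !ffunE; case: eqP => // _; rewrite ordSK.
Qed.

Lemma prev_cellK i : cancel (prev_cell i) (@next_cell R d a b G i).
Proof.
by move=> K; apply/ffunP => j; rewrite !ffunE; case: eqP => // _; rewrite ord_predK.
Qed.

Lemma next_cellC i j K : next_cell i (next_cell j K) = next_cell j (next_cell i K).
Proof. by apply/ffunP => k; rewrite !ffunE; case: eqP => //; case: eqP. Qed.

Lemma next_cell_prev i j K :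
  next_cell i (prev_cell j K) = prev_cell j (next_cell i K).
Proof.
by apply: (can_inj (next_cellK j)); rewrite prev_cellK next_cellC prev_cellK.
Qed.

Lemma next_cell_neq i K : K != next_cell i K.
Proof.
apply/eqP => /ffunP /(_ i); rewrite !ffunE eqxx => /(congr1 val) /=.
have := ncells_gt1 G i; have := ltn_ord (K i); move: (K i : nat) => m.
(* The last index wraps around to 0, a fixed point only if there were a single cell; any other index
   strictly increases. *)
rewrite leq_eqVlt => /predU1P[<-|mn _].
  by rewrite modnn => n1 m0; move: n1; rewrite m0.
by rewrite modn_small// => /eqP; rewrite ltn_eqF.
Qed.

Lemma lo_neq_hi s : lo s != hi s.
Proof. exact: next_cell_neq. Qed.

Lemma dlo_neq_dhi e : dlo e != dhi e.
Proof.
apply/eqP => /(congr1 snd) /= /eqP.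
by rewrite (negPf (next_cell_neq _ _)).
Qed.

Lemma sum_faces_cells (f : face G -> cell G -> R) :
  \sum_K \sum_(s in faces K) f s K = \sum_s (f s (lo s) + f s (hi s)).
Proof.
rewrite (exchange_big_dep xpredT)//=; apply: eq_bigr => s _.
by rewrite -big_pred2 ?lo_neq_hi//; apply: eq_bigl => K; rewrite inE.
Qed.

Lemma sum_dual_faces_faces (f : dual_face G -> face G -> R) :
  \sum_s \sum_(e in dual_faces s) f e s = \sum_e (f e (dlo e) + f e (dhi e)).
Proof.
rewrite (exchange_big_dep xpredT)//=; apply: eq_bigr => e _.
by rewrite -big_pred2 ?dlo_neq_dhi//; apply: eq_bigl => s; rewrite inE.
Qed.

Lemma sum_faces K (f : face G -> R) :
  \sum_(s in faces K) f s
  = \sum_j (f (j, K) + f (j, prev_cell j K)).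
Proof.
rewrite -(sum_adjacent (next := @next_cell R d a b G) (prev := prev_cell)
  (fun j C => f (j, C)) K)//.
- by apply: eq_big => [s|[]//]; rewrite inE.
- exact: next_cellK.
- exact: prev_cellK.
- exact: next_cell_neq.
Qed.

Lemma sum_dual_faces s (f : dual_face G -> R) :
  \sum_(e in dual_faces s) f e = \sum_j (f (s, j) + f (prev_face j s, j)).
Proof.
pose next j (t : face G) : face G := (dir t, next_cell j (lo t)).
rewrite -(sum_adjacent (next := next) (prev := prev_face) (fun j t => f (t, j)) s).
(* A dual face stores its direction second, whereas [sum_adjacent] indexes pairs with the direction
   first. *)
- rewrite (reindex swap_pair)/=; last first.
    exact: onW_bij (Bijective swap_pairK swap_pairK).
  by apply: eq_big => [[]|[]//]//= i t; rewrite inE.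
- by move=> j [i K]; rewrite /prev_face /next /= next_cellK.
- by move=> j [i K]; rewrite /prev_face /next /= prev_cellK.
- by move=> j t; exact: (dlo_neq_dhi (t, j)).
Qed.

End MeshSums.

(** * Primal and dual mass fluxes *)

Section Fluxes.
Context {R : realType} {d : nat} {a b : 'I_d -> R} {G : macGrid a b}.
Variables (rho : cell G -> R) (u : face G -> R).
Implicit Types (K : cell G) (s : face G) (e : dual_face G) (i j : 'I_d).

Lemma width_gt0 i (j : 'I_(ncells G i)) : 0 < width j.
Proof. by rewrite subr_gt0 node_lt. Qed.

Lemma cell_vol_gt0 K : 0 < cell_vol K.
Proof. by apply: prodr_gt0 => i _; exact: width_gt0. Qed.

Lemma face_area_ge0 s : 0 <= face_area s.
Proof. by apply: prodr_ge0 => i _; rewrite ltW ?width_gt0. Qed.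

Lemma dual_vol_gt0 s : 0 < dual_vol s.
Proof. by rewrite divr_gt0 ?addr_gt0 ?cell_vol_gt0. Qed.

Lemma dual_vol_grad (q : cell G -> R) s :
  dual_vol s * grad q s = face_area s * (q (hi s) - q (lo s)).
Proof. by rewrite /grad mulrA mulrCA mulfV ?mulr1// gt_eqF ?dual_vol_gt0. Qed.

Lemma dual_vol_density s : dual_vol s * dual_density rho s
  = cell_vol (lo s) * rho (lo s) / 2 + cell_vol (hi s) * rho (hi s) / 2.
Proof. by rewrite mulrC divfK// gt_eqF ?dual_vol_gt0. Qed.

Lemma opp_cell_lo s : opp_cell s (lo s) = hi s.
Proof. by rewrite /opp_cell eqxx. Qed.

Lemma opp_cell_hi s : opp_cell s (hi s) = lo s.
Proof. by rewrite /opp_cell eq_sym (negPf (lo_neq_hi _)). Qed.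

Lemma outward_lo s : outward u s (lo s) = u s.
Proof. by rewrite /outward /nu eqxx mulr1. Qed.

Lemma outward_hi s : outward u s (hi s) = - u s.
Proof. by rewrite /outward /nu eq_sym (negPf (lo_neq_hi _)) mulrN1. Qed.

Lemma opp_face_lo e : opp_face e (dlo e) = dhi e.
Proof. by rewrite /opp_face eqxx. Qed.

Lemma opp_face_hi e : opp_face e (dhi e) = dlo e.
Proof. by rewrite /opp_face eq_sym (negPf (dlo_neq_dhi _)). Qed.

(** One signed number per face, counted positive along its unit vector; by conservativity it
    determines the fluxes seen from both adjacent cells. *)
Definition edge_flux s : R := mass_flux rho u s (lo s).

Lemma mass_flux_hi s : mass_flux rho u s (hi s) = - edge_flux s.
Proof.
rewrite /edge_flux /mass_flux opp_cell_lo opp_cell_hi outward_lo outward_hi.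
by rewrite pospartN negpartN; ring.
Qed.

(* The two cases in the definition of the dual flux agree on this formula. *)
Lemma dual_flux_lo e : dual_flux rho u e (dlo e)
  = (edge_flux (ddir e, lo (dlo e)) + edge_flux (ddir e, hi (dlo e))) / 2.
Proof.
rewrite /dual_flux eqxx opp_face_lo; case: eqP => [ej|//].
rewrite mass_flux_hi opprK addrC; congr ((_ + _) / 2).
- by rewrite ej; case: (dlo e).
- by rewrite /edge_flux /dhi ej; case: (dlo e).
Qed.

(** Conservativity is inherited from the primal fluxes; in the transverse case it also uses that
    shifts in two directions commute. *)
Lemma dual_flux_hi e : dual_flux rho u e (dhi e) = - dual_flux rho u e (dlo e).
Proof.
rewrite dual_flux_lo /dual_flux [dhi e == dlo e]eq_sym (negPf (dlo_neq_dhi _)).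
rewrite opp_face_hi.
have -> : dir (dhi e) = dir (dlo e) by [].
case: eqP => [ej|_].
  have -> : lo (dhi e) = hi (dlo e) by rewrite /hi -ej.
  rewrite mass_flux_hi -[in RHS]mulNr opprD; congr ((_ - _) / 2).
    by rewrite ej; case: (dlo e).
  by rewrite /edge_flux /dhi ej; case: (dlo e).
have -> : lo (dhi e) = hi (ddir e, lo (dlo e)) by [].
have -> : hi (dhi e) = hi (ddir e, hi (dlo e)) by rewrite /hi /= next_cellC.
by rewrite !mass_flux_hi -opprD [in LHS]mulNr.
Qed.

Lemma sum_mass_flux K : \sum_(s in faces K) mass_flux rho u s K
  = \sum_j (edge_flux (j, K) - edge_flux (j, prev_cell j K)).
Proof.
rewrite sum_faces; apply: eq_bigr => j _; congr (_ + _).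
by rewrite -mass_flux_hi /hi /= prev_cellK.
Qed.

Lemma sum_norm_mass_flux K : \sum_(s in faces K) `|mass_flux rho u s K|
  = \sum_j (`|edge_flux (j, K)| + `|edge_flux (j, prev_cell j K)|).
Proof.
rewrite sum_faces; apply: eq_bigr => j _; congr (_ + _).
by rewrite -[in RHS]normrN -mass_flux_hi /hi /= prev_cellK.
Qed.

Lemma dual_flux_prev j s : dual_flux rho u (prev_face j s, j) s
  = - ((edge_flux (j, prev_cell j (lo s))
        + edge_flux (j, prev_cell j (hi s))) / 2).
Proof.
have {2}-> : s = dhi (prev_face j s, j).
  by case: s => i K; rewrite /dhi /prev_face /= prev_cellK.
by rewrite dual_flux_hi dual_flux_lo /= /hi /= next_cell_prev.
Qed.

(** This makes the dual density satisfy a mass balance, the mean of those of the two primal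
    cells. *)
Lemma sum_dual_flux s : \sum_(e in dual_faces s) dual_flux rho u e s
  = (\sum_(t in faces (lo s)) mass_flux rho u t (lo s)
     + \sum_(t in faces (hi s)) mass_flux rho u t (hi s)) / 2.
Proof.
rewrite sum_dual_faces !sum_mass_flux -big_split /= mulr_suml.
apply: eq_bigr => j _; rewrite dual_flux_prev (dual_flux_lo (s, j)) /=.
by rewrite -mulrBl; congr (_ / _); ring.
Qed.

(** By the triangle inequality; it carries the CFL condition from primal to dual cells. *)
Lemma sum_norm_dual_flux s : \sum_(e in dual_faces s) `|dual_flux rho u e s|
  <= (\sum_(t in faces (lo s)) `|mass_flux rho u t (lo s)|
     + \sum_(t in faces (hi s)) `|mass_flux rho u t (hi s)|) / 2.
Proof.
rewrite sum_dual_faces !sum_norm_mass_flux -big_split /= mulr_suml.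
apply: ler_sum => j _; rewrite dual_flux_prev (dual_flux_lo (s, j)) /=.
rewrite normrN !(normrM _ 2^-1) (ger0_norm (_ : 0 <= 2^-1)) ?invr_ge0// -mulrDl.
rewrite ler_pM2r ?invr_gt0// [leRHS]addrACA.
exact: lerD (ler_normD _ _) (ler_normD _ _).
Qed.

(* Where the upwind value differs from the centred one, the flux is negative. *)
Lemma upwind_jump e s : dual_flux rho u e s * (upwind rho u e s - u s)
  = - (`|dual_flux rho u e s| * (upwind rho u e s - u s)).
Proof.
rewrite /upwind; case: leP => [_|F0]; first by rewrite subrr !mulr0 oppr0.
by rewrite ltr0_norm// mulNr opprK.
Qed.

(** The two sides of a dual face select the same upwind value when the flux is nonzero, so their
    contributions cancel; a zero flux contributes nothing. *)
Lemma sum_upwind_conservative (f : R -> R) :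
  \sum_s \sum_(e in dual_faces s) dual_flux rho u e s * f (upwind rho u e s) = 0.
Proof.
rewrite (sum_dual_faces_faces
  (fun e s => dual_flux rho u e s * f (upwind rho u e s))).
apply: big1 => e _; rewrite /upwind dual_flux_hi opp_face_lo opp_face_hi.
rewrite oppr_ge0; case: ltgtP => [_|_|<-]; last by rewrite oppr0 !mul0r addr0.
- by rewrite mulNr subrr.
- by rewrite mulNr subrr.
Qed.

(* A form of the Cauchy-Schwarz inequality with weights |F|. *)
Lemma upwind_young s m :
  2 * m * (\sum_(e in dual_faces s) `|dual_flux rho u e s|
             * (upwind rho u e s - u s))
  <= m ^+ 2 * (\sum_(e in dual_faces s) `|dual_flux rho u e s|)
     + \sum_(e in dual_faces s) `|dual_flux rho u e s|
         * (upwind rho u e s - u s) ^+ 2.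
Proof.
rewrite !mulr_sumr -big_split/=; apply: ler_sum => e _.
rewrite -subr_ge0; set x := upwind _ _ _ _ - _; set F := `|_|.
have -> : m ^+ 2 * F + F * x ^+ 2 - 2 * m * (F * x) = F * (x - m) ^+ 2 by ring.
by rewrite mulr_ge0 ?sqr_ge0 ?normr_ge0.
Qed.

End Fluxes.

(** * Kinetic energy *)

(* S_k stands for the sum of F u_up^k over the faces of a dual cell, P for that
   of |F|, g for the pressure gradient and e for 1 / eps^2. *)
Lemma kinetic_algebra {R : realType} (D dt r r' u u' S0 S1 S2 P g e eta : R) :
  0 < D -> 0 < dt -> 0 < r ->
  D * (r' - r) = - (dt * S0) ->
  D * (r' * u' - r * u) = - (dt * S1) - dt * (D * g * e) ->
  dt * P <= D * r / 3 -> 2 / 3 * r <= r' -> 3 / (2 * r) <= eta ->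
  (forall m, 2 * m * (u * S0 - S1) <= m ^+ 2 * P
             - (S2 - 2 * u * S1 + u ^+ 2 * S0)) ->
  D * (2^-1 * r' * u' ^+ 2) - D * (2^-1 * r * u ^+ 2)
  <= dt * (- (2^-1 * S2) - D * g * u * e + eta * dt * D * g ^+ 2 * e ^+ 2).
Proof.
move=> D0 dt0 r0 Hmass Hmom cfl r'r Heta young.
have r'0 : 0 < r' by apply: lt_le_trans r'r; rewrite mulr_gt0// divr_gt0.
have DN0 := lt0r_neq0 D0; have r'N0 := lt0r_neq0 r'0; have rN0 := lt0r_neq0 r0.
pose X := u * S0 - S1; pose Y := - (S2 - 2 * u * S1 + u ^+ 2 * S0).
pose c := dt / (D * r').
have Dr'0 : 0 < D * r' by rewrite mulr_gt0.
have c0 : 0 < c by rewrite divr_gt0.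
(* The ratio of the CFL constant 1/3 to the constant 2/3 of the density bound. *)
have cP : c * P <= 2^-1.
  rewrite /c mulrAC ler_pdivrMr// (le_trans cfl)//.
  have : D * (2 / 3 * r) <= D * r' by rewrite ler_pM2l.
  by lra.
have XY : 2 * (c * X ^+ 2) <= Y.
  (* The optimal [m] is [X / P]; here [P] is replaced by its upper bound [1 / (2 * c)]. *)
  have := young (2 * (c * X)); rewrite -/X -/Y.
  have : 4 * c * X ^+ 2 * (c * P) <= 4 * c * X ^+ 2 * 2^-1.
    by rewrite ler_wpM2l// mulr_ge0 ?sqr_ge0// mulr_ge0 ?(ltW c0).
  have -> : 4 * c * X ^+ 2 * (c * P) = (2 * (c * X)) ^+ 2 * P by ring.
  have -> : 4 * c * X ^+ 2 * 2^-1 = 2 * (c * X ^+ 2) by field.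
  have -> : 2 * (2 * (c * X)) * X = 4 * (c * X ^+ 2) by ring.
  by move: (_ ^+ 2 * P) (c * X ^+ 2) => v w; lra.
pose B := dt * g * e.
(* The constant 3/2 in the condition on [eta] is the inverse of the 2/3 in the density bound. *)
have r'eta : r'^-1 <= eta.
  apply: le_trans Heta; rewrite -[3 / _]invrK lef_pV2 ?posrE ?invr_gt0//.
    by rewrite invf_div (le_trans _ r'r)//; lra.
  by rewrite divr_gt0// mulr_gt0.
have BB : D * B ^+ 2 / r' <= eta * (D * B ^+ 2).
  by rewrite mulrC ler_wpM2r// mulr_ge0 ?sqr_ge0// ltW.
(* [u' - u] is the sum of an upwinding and a pressure contribution. *)
have Hu : D * r' * (u' - u) = dt * X - D * B.
  have -> : D * r' * (u' - u) = D * (r' * u' - r * u) - u * (D * (r' - r)).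
    by ring.
  by rewrite Hmass Hmom /X /B; ring.
(* This is [(x - y)^2 <= 2 x^2 + 2 y^2], whose defect is the square of [x + y]. *)
have sq : D * r' * (u' - u) ^+ 2 <= 2 * (dt * c * X ^+ 2) + 2 * (D * B ^+ 2 / r').
  have -> : u' - u = (dt * X - D * B) / (D * r').
    by rewrite -Hu; field; rewrite ?DN0 ?r'N0.
  rewrite -subr_ge0 /c.
  set T := (X in 0 <= X).
  have -> : T = (dt * X + D * B) ^+ 2 / (D * r').
    by rewrite /T; field; rewrite ?DN0 ?r'N0.
  by rewrite divr_ge0 ?sqr_ge0 ?ltW.
have key : D * (2^-1 * r' * u' ^+ 2) - D * (2^-1 * r * u ^+ 2)
   = 2^-1 * (D * r' * (u' - u) ^+ 2) + u * (D * (r' * u' - r * u))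
     - 2^-1 * u ^+ 2 * (D * (r' - r)) by field.
rewrite key Hmass Hmom.
have dXY : dt * (2 * (c * X ^+ 2)) <= dt * Y by rewrite ler_pM2l.
have -> : dt * (- (2^-1 * S2) - D * g * u * e + eta * dt * D * g ^+ 2 * e ^+ 2)
  = dt * (- (2^-1 * S2) - D * g * u * e) + eta * (D * B ^+ 2) by rewrite /B; ring.
have -> : u * (- (dt * S1) - dt * (D * g * e)) =
  - (u * (dt * S1)) - dt * (D * g * u * e) by ring.
(* Half of [dt * Y] cancels the terms in [S0] and [S1], leaving only the conservative energy flux
   [S2]. *)
move: sq dXY BB; rewrite /Y; move: (D * B ^+ 2 / r') (eta * _) => v w.
by move: (D * r' * _) => z; lra.
Qed.

Section KineticEnergy.
Context {R : realType} {d : nat} {a b : 'I_d -> R} {G : macGrid a b}.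
Variables (gamma eps eta dt : R) (rho rho' theta' : cell G -> R).
Variables (u u' : face G -> R).
Hypothesis dt_gt0 : 0 < dt.
Hypothesis rho_gt0 : forall K, 0 < rho K.
Hypothesis mass : mass_balance dt rho rho' u.
Hypothesis momentum : momentum_balance gamma eps dt rho rho' theta' u u'.
Hypothesis eta_ge : forall s, 3 / (2 * dual_density rho s) <= eta.
Hypothesis cfl : forall K, dt / cell_vol K *
  \sum_(s in faces K) (`|mass_flux rho u s K| / rho K) <= 1 / 3.

Let mass_cell K : cell_vol K * (rho' K - rho K)
  = - (dt * \sum_(s in faces K) mass_flux rho u s K).
Proof.
by apply: explicit_balance (mass K); rewrite lt0r_neq0 ?cell_vol_gt0.
Qed.

Let cfl_cell K : dt * \sum_(s in faces K) `|mass_flux rho u s K|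
  <= cell_vol K * rho K / 3.
Proof.
have v0 := cell_vol_gt0 K; have r0 := rho_gt0 K; have := cfl K.
rewrite -mulr_suml; move: (\sum_(s in _) _) => S.
rewrite -(ler_pM2r (mulr_gt0 v0 r0)); congr (_ <= _); last by ring.
by field; rewrite !gt_eqF.
Qed.

(** By the CFL condition at most a third of the mass of a cell leaves it in one step. *)
Let density_cell K : 2 / 3 * rho K <= rho' K.
Proof.
have v0 := cell_vol_gt0 K; rewrite -(ler_pM2l v0).
have : dt * \sum_(s in faces K) mass_flux rho u s K
       <= dt * \sum_(s in faces K) `|mass_flux rho u s K|.
  by rewrite ler_pM2l//; apply: ler_sum => s _; exact: ler_norm.
by move: (mass_cell K) (cfl_cell K); lra.
Qed.

Lemma kinetic_face s :
  dual_vol s * (2^-1 * dual_density rho' s * u' s ^+ 2)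
  - dual_vol s * (2^-1 * dual_density rho s * u s ^+ 2)
  <= dt * (- (2^-1 * \sum_(e in dual_faces s) dual_flux rho u e s
        * upwind rho u e s ^+ 2)
    - dual_vol s * grad (pressure gamma rho' theta') s * u s * (eps ^+ 2)^-1
    + eta * dt * dual_vol s * grad (pressure gamma rho' theta') s ^+ 2
      * (eps ^+ 2)^-1 ^+ 2).
Proof.
pose F e := dual_flux rho u e s; have D0 := dual_vol_gt0 s; have DN0 := lt0r_neq0 D0.
have dtN0 := lt0r_neq0 dt_gt0.
have Ddens q : dual_vol s * dual_density q s = _ := dual_vol_density q s.
apply: (@kinetic_algebra _ _ _ _ _ _ _ (\sum_(e in dual_faces s) F e)
  (\sum_(e in dual_faces s) F e * upwind rho u e s) _
  (\sum_(e in dual_faces s) `|F e|)) => //.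
- rewrite -(pmulr_rgt0 _ D0) Ddens.
  by rewrite addr_gt0// divr_gt0// mulr_gt0 ?cell_vol_gt0.
- rewrite mulrBr !Ddens sum_dual_flux.
  move: (mass_cell (lo s)) (mass_cell (hi s)); rewrite !mulrBr.
  by move: (\sum_(t in _) _) (\sum_(t in _) _) => A B *; lra.
- move: (momentum s); rewrite -addrA.
  set S := \sum_(e in _) _; set g := grad _ _ => E.
  (* The pressure term joins the flux sum under the common factor [(dual_vol s)^-1]. *)
  rewrite (@explicit_balance _ dt _ _ (S + dual_vol s * g * (eps ^+ 2)^-1))//.
    by rewrite mulrDr opprD.
  by rewrite [_ * (S + _)]mulrDr -(mulrA (dual_vol s)) mulKf// [g * _]mulrC.
- have := sum_norm_dual_flux rho u s; rewrite -(ler_pM2l dt_gt0) Ddens.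
  move: (cfl_cell (lo s)) (cfl_cell (hi s)).
  by rewrite mulrA mulrDr; lra.
- rewrite -(ler_pM2l D0) mulrCA !Ddens.
  have dens K : cell_vol K * (2 / 3 * rho K) <= cell_vol K * rho' K.
    by rewrite ler_pM2l ?cell_vol_gt0.
  by move: (dens (lo s)) (dens (hi s)); lra.
(* By [upwind_jump], the combinations of [S0], [S1], [S2] are, up to sign, sums of [|F|] times the
   upwind jump or its square. *)
- move=> m; have := upwind_young rho u s m; congr (_ <= _).
  + congr (_ * _); rewrite /F mulr_sumr -sumrB; apply: eq_bigr => e _.
    transitivity (- (dual_flux rho u e s * (upwind rho u e s - u s))); last by ring.
    by rewrite upwind_jump opprK.
  + congr (_ + _); rewrite /F !mulr_sumr -sumrB -big_split -sumrN /=.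
    apply: eq_bigr => e _.
    transitivity (- (dual_flux rho u e s * (upwind rho u e s - u s))
      * (upwind rho u e s - u s)); last by ring.
    by rewrite upwind_jump opprK expr2 mulrA.
Qed.

Lemma kinetic_energy_estimate :
  \sum_s dual_vol s * (2^-1 * dual_density rho' s * u' s ^+ 2)
  - \sum_s dual_vol s * (2^-1 * dual_density rho s * u s ^+ 2)
  <= - ((eps ^+ 2)^-1 * (dt * \sum_s dual_vol s
         * grad (pressure gamma rho' theta') s
         * (u s - delta_u eta dt eps (pressure gamma rho' theta') s))).
Proof.
rewrite -sumrB; apply: le_trans (ler_sum _ (fun s _ => kinetic_face s)) _.
rewrite -mulr_sumr; under eq_bigr do rewrite -addrA.
rewrite big_split /= sumrN -mulr_sumr.
(* The kinetic energy fluxes telescope; what remains is pressure work. *)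
rewrite (sum_upwind_conservative rho u (fun x => x ^+ 2)) mulr0 oppr0 add0r.
rewrite !mulr_sumr -sumrN le_eqVlt; apply/orP; left; apply/eqP.
by apply: eq_bigr => s _; rewrite /delta_u; ring.
Qed.

End KineticEnergy.

(** * Internal energy *)

Section InternalEnergy.
Context {R : realType} {d : nat} {a b : 'I_d -> R} {G : macGrid a b}.
Variables (gamma eps eta dt : R) (rho theta rho' theta' : cell G -> R).
Variables (u : face G -> R).
Hypotheses (gamma_gt1 : 1 < gamma) (dt_gt0 : 0 < dt).

Lemma stab_flux_hi (q : cell G -> R) (v w : face G -> R) s :
  stab_flux q v w s (hi s) = - stab_flux q v w s (lo s).
Proof.
rewrite /stab_flux opp_cell_lo opp_cell_hi !outward_lo !outward_hi.
by rewrite !pospartN !negpartN; ring.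
Qed.

(** The stabilised velocity is split into a nonnegative part carrying [q (lo s)] and a nonpositive
    one carrying [q (hi s)]. [pressure_jump_le] applies to each with its donor value, and the two
    parts add up to [v s - w s]. *)
Lemma stab_flux_dpsi_ge (q : cell G -> R) (v w : face G -> R) s :
  (forall K, 0 < q K) ->
  face_area s * ((v s - w s) * (q (lo s) `^ gamma - q (hi s) `^ gamma))
  <= stab_flux q v w s (lo s) * (dpsi gamma (q (lo s)) - dpsi gamma (q (hi s))).
Proof.
move=> q0; rewrite /stab_flux opp_cell_lo !outward_lo -mulrA.
rewrite ler_wpM2l ?face_area_ge0//.
rewrite -{1}(pos_negpartD (v s)) -{1}(pos_negpartD (w s)).
have jump_lo := pressure_jump_le gamma_gt1 (q0 (lo s)) (q0 (hi s)).
have jump_hi := pressure_jump_le gamma_gt1 (q0 (hi s)) (q0 (lo s)).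
have plus_ge0 : 0 <= pospart (v s) - negpart (w s).
  by rewrite subr_ge0 (le_trans (negpart_le0 _)) ?pospart_ge0.
have minus_ge0 : 0 <= pospart (w s) - negpart (v s).
  by rewrite subr_ge0 (le_trans (negpart_le0 _)) ?pospart_ge0.
move: (ler_wpM2l plus_ge0 jump_lo) (ler_wpM2l minus_ge0 jump_hi); lra.
Qed.

Hypothesis q_gt0 : forall K, 0 < rho K * theta K.
Hypothesis q'_gt0 : forall K, 0 < rho' K * theta' K.
Hypothesis temperature :
  temperature_balance gamma eps eta dt rho theta rho' theta' u.

Lemma internal_energy_estimate :
  \sum_K cell_vol K * Pi_gamma gamma (rho' K * theta' K)
  - \sum_K cell_vol K * Pi_gamma gamma (rho K * theta K)
  <= dt * \sum_s dual_vol s * grad (pressure gamma rho' theta') s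
    * (u s - delta_u eta dt eps (pressure gamma rho' theta') s).
Proof.
pose q' K := rho' K * theta' K.
pose du := delta_u eta dt eps (pressure gamma rho' theta').
(* The value of psi'(1) is irrelevant: it multiplies a conserved total. *)
pose c := derive1 (psi gamma) (1 : R).
have step K : cell_vol K * (q' K - rho K * theta K)
    = - (dt * \sum_(s in faces K) stab_flux q' u du s K).
  by apply: explicit_balance (temperature K); rewrite lt0r_neq0 ?cell_vol_gt0.
rewrite -sumrB.
(* The tangent is taken at the new value [q'], so the convexity remainder has the favourable
   sign. *)
apply: (@le_trans _ _ (\sum_K (dpsi gamma (q' K) - c)
    * (cell_vol K * (q' K - rho K * theta K)))).
  apply: ler_sum => K _; rewrite -mulrBr [leRHS]mulrCA ler_pM2l ?cell_vol_gt0//.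
  have := psi_tangent gamma_gt1 (q_gt0 K) (q'_gt0 K).
  rewrite /Pi_gamma -/(q' K) -/c.
  by move: (psi _ _) (psi _ _) (psi _ _) (dpsi _ _) => *; lra.
under eq_bigr do rewrite step mulrN mulrCA -mulrN.
rewrite -mulr_sumr ler_pM2l// sumrN lerNl -sumrN.
under [leRHS]eq_bigr do rewrite mulr_sumr.
rewrite (sum_faces_cells (fun s K =>
  (dpsi gamma (q' K) - c) * stab_flux q' u du s K)).
apply: ler_sum => s _; rewrite stab_flux_hi.
apply: (le_trans (y := face_area s
  * ((u s - du s) * (q' (lo s) `^ gamma - q' (hi s) `^ gamma)))).
  rewrite dual_vol_grad /pressure -/(q' _) -/(q' _) -/du le_eqVlt.
  by apply/orP; left; apply/eqP; ring.
apply: le_trans (stab_flux_dpsi_ge _ _ _ _) _ => //.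
by rewrite le_eqVlt; apply/orP; left; apply/eqP; ring.
Qed.

End InternalEnergy.

(** * Total energy *)

Theorem theorem3p5 (R : realType) (d : nat) (d_gt0 : (0 < d)%N)
  (d_le3 : (d <= 3)%N) (a b : 'I_d -> R) (G : macGrid a b)
  (gamma eps eta dt : R) (gamma_gt1 : 1 < gamma)
  (eps_gt0 : 0 < eps) (eps_le1 : eps <= 1) (eta_gt0 : 0 < eta) (dt_gt0 : 0 < dt)
  (N : nat) (N_gt0 : (0 < N)%N)
  (rho theta : nat -> cell G -> R) (u : nat -> face G -> R)
  (rho_gt0 : forall n K, (n <= N)%N -> 0 < rho n K)
  (theta_gt0 : forall n K, (n <= N)%N -> 0 < theta n K)
  (mass : forall n, (n < N)%N -> mass_balance dt (rho n) (rho n.+1) (u n))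
  (momentum : forall n, (n < N)%N ->
     momentum_balance gamma eps dt (rho n) (rho n.+1) (theta n.+1)
       (u n) (u n.+1))
  (temperature : forall n, (n < N)%N ->
     temperature_balance gamma eps eta dt (rho n) (theta n)
       (rho n.+1) (theta n.+1) (u n)) :
  forall n, (n < N)%N ->
    (forall s : face G, 3 / (2 * dual_density (rho n) s) <= eta) ->
    (forall K : cell G,
       dt / cell_vol K *
         \sum_(s in faces K) (`|mass_flux (rho n) (u n) s K| / rho n K)
       <= 1 / 3) ->
    energy gamma eps (rho n.+1) (theta n.+1) (u n.+1)
    <= energy gamma eps (rho n) (theta n) (u n).
Proof.
move=> n nN eta_ge cfl.
have q_gt0 m K : (m <= N)%N -> 0 < rho m K * theta m K.
  by move=> mN; rewrite mulr_gt0 ?rho_gt0 ?theta_gt0.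
have kin := kinetic_energy_estimate dt_gt0 (fun K => rho_gt0 n K (ltnW nN))
  (mass n nN) (momentum n nN) eta_ge cfl.
have := internal_energy_estimate gamma_gt1 dt_gt0
  (fun K => q_gt0 n K (ltnW nN)) (fun K => q_gt0 n.+1 K nN) (temperature n nN).
have e_gt0 : 0 < (eps ^+ 2)^-1 by rewrite invr_gt0 exprn_gt0.
(* Scaled by [(eps ^+ 2)^-1], the internal pressure work is opposite to the kinetic one. *)
rewrite -(ler_pM2l e_gt0) /energy; lra.
Qed.
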